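(* Let $Z_1,\dots,Z_n$ be i.i.d. with distribution $Q$ on a measurable space $\mathcal Z$ and $\psi:\mathcal Z\to\mathbb R^d$ measurable with $\int\|\psi\|^2dQ<\infty$. Let $m_n\to\infty$ and, for each $n$, let $T_{n1},\dots,T_{nn}$ be $m_n$-dimensional random vectors (defined on the same probability space as the $Z_j$). Let $T_n^*=\max_{1\le j\le n}\|T_{nj}\|$, $\bar T_n=\frac1n\sum_{j=1}^nT_{nj}$, $\mathbb S_n=\frac1n\sum_{j=1}^nT_{nj}T_{nj}^\top$, and $A_n=\frac1n\sum_{j=1}^nE\big(\psi(Z_j)T_{nj}^\top\big)$. Assume: (A1) $T_n^*=o_p(m_n^{-3/2}n^{1/2})$; (A2) $\|\bar T_n\|=O_p(m_n^{1/2}n^{-1/2})$; (A3) there is a regular sequence of $m_n\times m_n$ dispersion matrices $W_n$ with $|\mathbb S_n-W_n|_o=o_p(m_n^{-1})$; (B1) $\frac1n\sum_{j=1}^n\big(\psi(Z_j)T_{nj}^\top-E[\psi(Z_j)T_{nj}^\top]\big)=o_p(m_n^{-1/2})$; (B2) there is a measurable $\chi:\mathcal Z\to\mathbb R^d$ with $\int\chi\,dQ=0$, $\int\|\chi\|^2dQ<\infty$ and $\frac1n\sum_{i=1}^n\big(A_nW_n^{-1}T_{ni}-\chi(Z_i)\big)=o_p(n^{-1/2})$. Then, on an event whose probability tends to one, there exists a unique $\zeta_n\in\mathbb R^{m_n}$ with $$1+\zeta_n^\top T_{nj}>0\ (j=1,\dots,n),\qquad \frac1n\sum_{j=1}^n\frac{T_{nj}}{1+\zeta_n^\top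 T_{nj}}=0,$$ and $$\theta_n:=\frac1n\sum_{j=1}^n\frac{\psi(Z_j)}{1+\zeta_n^\top T_{nj}}=\bar\psi-\bar\chi+o_p(n^{-1/2}),$$ where $\bar\psi=\frac1n\sum_j\psi(Z_j)$ and $\bar\chi=\frac1n\sum_j\chi(Z_j)$.
   Context: A sequence of $m_n\times m_n$ dispersion matrices $W_n$ is called regular if $0<\inf_n\inf_{\|a\|=1}a^\top W_na\le\sup_n\sup_{\|a\|=1}a^\top W_na<\infty$. $|A|_o$ denotes the spectral (operator) norm of a matrix. *)

(* Defs.v *)
From HB Require Import structures.
From mathcomp Require Import all_boot all_order all_algebra.
From mathcomp Require Import all_classical all_reals all_analysis.
Set Implicit Arguments. Unset Strict Implicit. Unset Printing Implicit Defensive.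
Import Order.TTheory GRing.Theory Num.Theory.
Import numFieldNormedType.Exports.
Local Open Scope classical_set_scope.
Local Open Scope ring_scope.

Section Defs.
Variable R : realType.

Definition vnorm (p : nat) (v : 'cV[R]_p) : R :=
  Num.sqrt (\sum_(i < p) v i 0 ^+ 2).

Definition frob (p q : nat) (A : 'M[R]_(p, q)) : R :=
  Num.sqrt (\sum_(i < p) \sum_(k < q) A i k ^+ 2).

Definition opnorm (p q : nat) (A : 'M[R]_(p, q)) : R :=
  sup [set vnorm (A *m x) | x in [set x : 'cV[R]_q | vnorm x = 1]].

Definition qform (p : nat) (W : 'M[R]_p) (a : 'cV[R]_p) : R :=
  ((a^T *m W *m a) 0 0).

Definition regular_seq (m : nat -> nat) (W : forall n, 'M[R]_(m n)) : Prop :=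
  (forall n, (W n)^T = W n) /\
  exists c C : R, 0 < c /\
    forall n (a : 'cV[R]_(m n)), vnorm a = 1 -> c <= qform (W n) a <= C.

Section Prob.
Context d0 (Om : measurableType d0) (P : probability Om R).

(* A (possibly non-measurable) set has outer probability < delta *)
Definition pr_small (A : set Om) (delta : R) : Prop :=
  exists B, measurable B /\ A `<=` B /\ (P B < delta%:E)%E.

(* X n = o_p(a n), for nonnegative (norm) quantities X n *)
Definition o_p (X : nat -> Om -> R) (a : nat -> R) : Prop :=
  forall eps delta : R, 0 < eps -> 0 < delta ->
    \forall n \near \oo, pr_small [set w | eps * a n < X n w] delta.

Definition O_p (X : nat -> Om -> R) (a : nat -> R) : Prop :=
  forall delta : R, 0 < delta -> exists M : R, 0 < M /\
    \forall n \near \oo, pr_small [set w | M * a n < X n w] delta.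

Definition expmx (p q : nat) (X : Om -> 'M[R]_(p, q)) : 'M[R]_(p, q) :=
  \matrix_(i, k) fine (\int[P]_w (X w i k)%:E)%E.

Definition iid_seq d1 (Zs : measurableType d1) (Q : probability Zs R)
  (Z : nat -> Om -> Zs) : Prop :=
  (forall j, measurable_fun setT (Z j)) /\
  (forall j (B : set Zs), measurable B -> P (Z j @^-1` B) = Q B) /\
  (forall (s : seq nat) (B : nat -> set Zs), uniq s ->
     (forall j, measurable (B j)) ->
     fine (P (\bigcap_(j in [set j | j \in s]) (Z j @^-1` B j))) =
     \prod_(j <- s) fine (P (Z j @^-1` B j))).
End Prob.
End Defs.

Section EL.
Variable R : realType.
Definition el_solution (p n : nat) (Tw : nat -> 'cV[R]_p) (z : 'cV[R]_p) : Prop :=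
  (forall j, (j < n)%N -> 0 < 1 + (z^T *m Tw j) 0 0) /\
  n%:R^-1 *: \sum_(j < n) ((1 + (z^T *m Tw j) 0 0)^-1 *: Tw j) = 0.
End EL.

(* Main.v *)
(* Concavity of [z |-> prod_j (1 + z . T_j)] on the log scale yields existence
   and uniqueness of the multiplier; a ball of radius [r ~ (m_n / n)^(1/2)]
   already contains the maximiser, because [r max_j |T_j| = o(1)] makes the log
   likelihood quadratic there, with curvature bounded below by the eigenvalues
   of [S_n]. Hence [|zeta_n| = O((m_n / n)^(1/2))], and expanding
   [1 / (1 + x) = 1 - x + x^2 / (1 + x)] once in the estimating equation
   (giving [W_n zeta_n] up to [o((m_n n)^(-1/2))]) and once in [theta_n] gives
   [theta_n = psibar - A_n W_n^-1 Tbar_n + o(n^(-1/2))]. Cauchy-Schwarz and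
   [mean |psi(Z_j)|^2 = O_p(1)] bound [A_n] and all remainders.
   All estimates are deterministic on the intersection of six events of large
   probability, with the scales [a = m_n^(1/2)], [b = n^(1/2)]. *)

Require Import Defs.
From HB Require Import structures.
From mathcomp Require Import all_boot all_order all_algebra.
From mathcomp Require Import all_classical all_reals all_analysis.
From mathcomp Require Import measurable_realfun.
From mathcomp Require Import ring lra.
Import Order.TTheory GRing.Theory Num.Theory.
Import numFieldNormedType.Exports.
Set Implicit Arguments. Unset Strict Implicit. Unset Printing Implicit Defensive.
Local Open Scope classical_set_scope.
Local Open Scope ring_scope.

(** * Euclidean geometry of column vectors and bounds for matrix norms *)

Section EuclideanSpace.
Context {R : realType}.

(** The squares of [C f - B g] add up to [C (A C - B^2)]; the factor [C] cancels unless it is 0, and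
    then [g] vanishes, hence so does [B]. *)
Lemma sum_cauchy_schwarz (I : finType) (f g : I -> R) :
  (\sum_i f i * g i) ^+ 2 <= (\sum_i f i ^+ 2) * (\sum_i g i ^+ 2).
Proof.
set A := \sum_i f i ^+ 2; set B := \sum_i f i * g i; set C := \sum_i g i ^+ 2.
have C0 : 0 <= C by apply: sumr_ge0 => i _; exact: sqr_ge0.
have H : 0 <= C * (A * C - B ^+ 2).
  rewrite (_ : C * _ = \sum_i (C * f i - B * g i) ^+ 2).
    by apply: sumr_ge0 => i _; exact: sqr_ge0.
  rewrite (eq_bigr (fun i => C ^+ 2 * f i ^+ 2 - (2 * C * B) * (f i * g i)
     + B ^+ 2 * g i ^+ 2)); last by move=> i _; ring.
  by rewrite big_split/= sumrB -!mulr_sumr -/A -/B -/C; ring.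
move: C0; rewrite le_eqVlt => /orP[/eqP C0|C0]; last first.
  by move: H; rewrite pmulr_rge0// subr_ge0.
suff -> : B = 0 by rewrite -C0 mulr0 expr0n.
have /psumr_eq0P g0 : forall i, true -> 0 <= g i ^+ 2 by move=> i _; exact: sqr_ge0.
apply: big1 => i _.
by have /eqP := g0 (esym C0) i erefl; rewrite sqrf_eq0 => /eqP ->; rewrite mulr0.
Qed.

Lemma scaled_sum_cauchy_schwarz (I : finType) (t : R) (f g : I -> R) :
  (t * \sum_i f i * g i) ^+ 2 <= (t * \sum_i f i ^+ 2) * (t * \sum_i g i ^+ 2).
Proof.
rewrite exprMn [leRHS]mulrACA -expr2.
apply: ler_wpM2l; first exact: sqr_ge0.
exact: sum_cauchy_schwarz.
Qed.

Definition dotv (p : nat) (u v : 'cV[R]_p) : R := (u^T *m v) 0 0.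

Lemma dotvE p (u v : 'cV[R]_p) : dotv u v = \sum_i u i 0 * v i 0.
Proof. by rewrite /dotv mxE; apply: eq_bigr => i _; rewrite mxE. Qed.

Lemma dotvC p (u v : 'cV[R]_p) : dotv u v = dotv v u.
Proof. by rewrite !dotvE; apply: eq_bigr => i _; rewrite mulrC. Qed.

Lemma dotvDr p (u v w : 'cV[R]_p) : dotv u (v + w) = dotv u v + dotv u w.
Proof. by rewrite /dotv mulmxDr mxE. Qed.

Lemma dotvDl p (u v w : 'cV[R]_p) : dotv (v + w) u = dotv v u + dotv w u.
Proof. by rewrite dotvC dotvDr !(dotvC u). Qed.

Lemma dotvZr p a (u v : 'cV[R]_p) : dotv u (a *: v) = a * dotv u v.
Proof. by rewrite /dotv -scalemxAr mxE. Qed.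

Lemma dotvZl p a (u v : 'cV[R]_p) : dotv (a *: u) v = a * dotv u v.
Proof. by rewrite dotvC dotvZr dotvC. Qed.

Lemma dotvBl p (u v w : 'cV[R]_p) : dotv (v - w) u = dotv v u - dotv w u.
Proof. by rewrite dotvDl -scaleN1r dotvZl mulN1r. Qed.

Lemma dotv0l p (u : 'cV[R]_p) : dotv 0 u = 0.
Proof. by rewrite -(scale0r u) dotvZl mul0r. Qed.

Lemma dotv0r p (u : 'cV[R]_p) : dotv u 0 = 0.
Proof. by rewrite dotvC dotv0l. Qed.

Lemma dotv_sumr p (u : 'cV[R]_p) (I : finType) (v : I -> 'cV[R]_p) :
  dotv u (\sum_i v i) = \sum_i dotv u (v i).
Proof. by rewrite /dotv mulmx_sumr summxE. Qed.

Lemma vnorm_ge0 p (v : 'cV[R]_p) : 0 <= vnorm v.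
Proof. exact: sqrtr_ge0. Qed.

Lemma vnorm_sqr p (v : 'cV[R]_p) : vnorm v ^+ 2 = dotv v v.
Proof.
rewrite sqr_sqrtr; last by apply: sumr_ge0 => i _; exact: sqr_ge0.
by rewrite dotvE; apply: eq_bigr => i _; rewrite expr2.
Qed.

Lemma vnorm_sqrE p (v : 'cV[R]_p) : vnorm v ^+ 2 = \sum_i v i 0 ^+ 2.
Proof. by rewrite vnorm_sqr dotvE; apply: eq_bigr => i _; rewrite expr2. Qed.

Lemma vnorm0 p : vnorm (0 : 'cV[R]_p) = 0.
Proof. by apply/eqP; rewrite -sqrf_eq0 vnorm_sqr dotv0l. Qed.

Lemma vnorm_eq0 p (v : 'cV[R]_p) : (vnorm v == 0) = (v == 0).
Proof.
apply/idP/eqP => [|->]; last by rewrite vnorm0.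
rewrite -sqrf_eq0 vnorm_sqrE psumr_eq0 => [/allP v0|i _]; last exact: sqr_ge0.
apply/colP => i; rewrite mxE.
by have := v0 i (mem_index_enum i); rewrite sqrf_eq0 => /eqP.
Qed.

Lemma dotv_le_vnorm p (u v : 'cV[R]_p) : `|dotv u v| <= vnorm u * vnorm v.
Proof.
rewrite -ler_sqr ?nnegrE ?mulr_ge0 ?vnorm_ge0// exprMn real_normK ?num_real//.
by rewrite !vnorm_sqrE dotvE sum_cauchy_schwarz.
Qed.

Lemma vnorm_le_dual p (v : 'cV[R]_p) b : 0 <= b ->
  (forall u, dotv u v <= b * vnorm u) -> vnorm v <= b.
Proof.
move=> b0 /(_ v); rewrite -vnorm_sqr expr2.
have [->//|v0] := eqVneq (vnorm v) 0.
by rewrite ler_pM2r// lt_def v0 vnorm_ge0.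
Qed.

Lemma vnormD p (u v : 'cV[R]_p) : vnorm (u + v) <= vnorm u + vnorm v.
Proof.
apply: vnorm_le_dual => [|w]; first by rewrite addr_ge0// vnorm_ge0.
rewrite dotvDr mulrDl ![_ * vnorm w]mulrC.
by apply: lerD; apply: le_trans (dotv_le_vnorm _ _); exact: ler_norm.
Qed.

Lemma vnormZ p a (v : 'cV[R]_p) : vnorm (a *: v) = `|a| * vnorm v.
Proof.
apply/eqP; rewrite -(eqrXn2 (n := 2)) ?mulr_ge0 ?vnorm_ge0//.
by rewrite exprMn !vnorm_sqr dotvZl dotvZr real_normK ?num_real// mulrA.
Qed.

Lemma vnormN p (v : 'cV[R]_p) : vnorm (- v) = vnorm v.
Proof. by rewrite -scaleN1r vnormZ normrN1 mul1r. Qed.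

Lemma vnormB p (u v : 'cV[R]_p) : vnorm (u - v) <= vnorm u + vnorm v.
Proof. by rewrite -(vnormN v) vnormD. Qed.

Lemma vnorm_mulmx_frob p q (A : 'M[R]_(p, q)) (x : 'cV[R]_q) :
  vnorm (A *m x) <= frob A * vnorm x.
Proof.
rewrite -ler_sqr ?nnegrE ?mulr_ge0 ?vnorm_ge0 ?sqrtr_ge0// exprMn !vnorm_sqrE.
rewrite sqr_sqrtr; last first.
  by apply: sumr_ge0 => i _; apply: sumr_ge0 => j _; exact: sqr_ge0.
rewrite mulr_suml; apply: ler_sum => i _.
by rewrite mxE sum_cauchy_schwarz.
Qed.

(** The values under the supremum are bounded by [frob A], so [opnorm A] is a true upper bound; a
    nonzero [x] is normalised first. *)
Lemma vnorm_mulmx_opnorm p q (A : 'M[R]_(p, q)) (x : 'cV[R]_q) :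
  vnorm (A *m x) <= opnorm A * vnorm x.
Proof.
have [->|x0] := eqVneq x 0; first by rewrite mulmx0 !vnorm0 mulr0.
have nx0 : 0 < vnorm x by rewrite lt_def vnorm_eq0 x0 vnorm_ge0.
rewrite -ler_pdivrMr//; apply: sup_ubound.
  exists (frob A) => _ [y /= y1 <-].
  by rewrite (le_trans (vnorm_mulmx_frob A y))// y1 mulr1.
exists ((vnorm x)^-1 *: x) => /=.
  by rewrite vnormZ ger0_norm ?invr_ge0 ?vnorm_ge0// mulVf ?gt_eqF.
by rewrite -scalemxAr vnormZ ger0_norm ?invr_ge0 ?vnorm_ge0// mulrC.
Qed.

(** By duality it suffices to bound [dotv u] of the sum, where Cauchy-Schwarz separates the vectors
    [x] from the weights [y]. This controls the remainders [R2], [R3] and the matrix [P] below. *)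
Lemma vnorm_scaled_sum_le p (I : finType) (t : R) (x : I -> 'cV[R]_p)
    (y : I -> R) (a b : R) : 0 <= t -> 0 <= a -> 0 <= b ->
  (forall u, t * \sum_i dotv u (x i) ^+ 2 <= (a * vnorm u) ^+ 2) ->
  t * \sum_i y i ^+ 2 <= b ^+ 2 ->
  vnorm (t *: \sum_i y i *: x i) <= a * b.
Proof.
move=> t0 a0 b0 xa yb; apply: vnorm_le_dual => [|u]; first exact: mulr_ge0.
rewrite dotvZr dotv_sumr.
under eq_bigr do rewrite dotvZr mulrC.
apply: (le_trans (ler_norm _)).
rewrite -ler_sqr ?nnegrE ?mulr_ge0 ?vnorm_ge0// real_normK ?num_real//.
apply: (le_trans (scaled_sum_cauchy_schwarz _ _ _)).
rewrite [in leRHS]mulrAC [leRHS]exprMn.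
by apply: ler_pM => //; apply: mulr_ge0 => //; apply: sumr_ge0 => i _;
  exact: sqr_ge0.
Qed.

Lemma dotv_scatter p (I : finType) (t : R) (x : I -> 'cV[R]_p) (u : 'cV[R]_p) :
  dotv u ((t *: \sum_i x i *m (x i)^T) *m u) = t * \sum_i dotv u (x i) ^+ 2.
Proof.
rewrite -scalemxAl dotvZr mulmx_suml dotv_sumr; congr (_ * _).
apply: eq_bigr => i _.
rewrite /dotv mulmxA [u^T *m _]mulmxA -(mulmxA _ (x i)^T) mxE big_ord1.
by rewrite -/(dotv (x i) u) dotvC.
Qed.

Lemma mulmx_sum_outer p q (I : finType) (t : R) (x : I -> 'cV[R]_p)
    (y : I -> 'cV[R]_q) (u : 'cV[R]_q) :
  (t *: \sum_i x i *m (y i)^T) *m u = t *: \sum_i dotv u (y i) *: x i.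
Proof.
rewrite -scalemxAl mulmx_suml; congr (_ *: _); apply: eq_bigr => i _.
rewrite -mulmxA dotvC; apply/colP => k; rewrite !mxE big_ord1 mulrC.
by congr (_ * _); rewrite /dotv mxE.
Qed.

End EuclideanSpace.

(** * Existence and uniqueness of the multiplier *)

Section EmpiricalLikelihood.
Context {R : realType}.

(** With [s] half of the claimed bound, [1 + y <= (1 + s)^2], and [ln (1 + s) <= s] counts twice. *)
Lemma ln1D_le_quad (y : R) : `|y| <= 2^-1 -> ln (1 + y) <= y - y ^+ 2 / 5.
Proof.
rewrite ler_norml => /andP[y1 y2].
pose s := y / 2 - y ^+ 2 / 10.
have s0 : -1 < s by rewrite /s; nra.
have ys : 1 + y <= (1 + s) ^+ 2.
  have -> : (1 + s) ^+ 2 = 1 + y + y ^+ 2 * (1 / 20 - y / 10 + y ^+ 2 / 100).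
    by rewrite /s; field.
  by rewrite lerDl mulr_ge0 ?sqr_ge0//; nra.
have y3 : 0 < 1 + y by lra.
have s3 : 0 < 1 + s by lra.
have : ln (1 + y) <= ln ((1 + s) ^+ 2) by rewrite ler_ln ?posrE ?exprn_gt0.
by rewrite lnXn// mulr2n => /le_trans; apply; have := le_ln1Dx s0; rewrite /s; lra.
Qed.

(** Applying [ln x <= x - 1] at [x = (1 + y)^-1] gives [ln (1 + y) >= y / (1 + y)]; then
    [1 + y >= 1/2] suffices. *)
Lemma ln1D_ge_quad (y : R) : `|y| <= 2^-1 -> y - 2 * y ^+ 2 <= ln (1 + y).
Proof.
rewrite ler_norml => /andP[y1 y2].
have y3 : 0 < 1 + y by lra.
have iy : 0 < (1 + y)^-1 by rewrite invr_gt0.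
have : ln (1 + ((1 + y)^-1 - 1)) <= (1 + y)^-1 - 1 by apply: le_ln1Dx; lra.
rewrite (_ : 1 + ((1 + y)^-1 - 1) = (1 + y)^-1); last by ring.
rewrite lnV ?posrE// => H.
have H2 : (1 + y)^-1 - 1 <= - (y - 2 * y ^+ 2).
  by rewrite lerBlDr -[leLHS]mul1r ler_pdivrMr//; nra.
by lra.
Qed.

Lemma ln_prod (I : finType) (f : I -> R) : (forall i, 0 < f i) ->
  ln (\prod_i f i) = \sum_i ln (f i).
Proof.
move=> f0.
suff [] : 0 < \prod_i f i /\ ln (\prod_i f i) = \sum_i ln (f i) by [].
elim/big_ind2 : _ => [|x1 x2 y1 y2 [x0 <-] [y0 <-]|i _//].
  by rewrite ln1.
by rewrite lnM ?posrE// mulr_gt0.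
Qed.

(** The ball is a closed subset of the compact cube [[-r, r]^p]. *)
Lemma compact_vnorm_ball p (r : R) :
  compact [set u : 'rV[R]_p | vnorm u^T <= r].
Proof.
have Kc : compact [set v : 'rV[R]_p | forall i, `[- r, r]%classic (v ord0 i)].
  by apply: (@rV_compact _ _ (fun=> `[- r, r]%classic)) => _; exact: segment_compact.
apply: (subclosed_compact _ Kc).
  have -> : [set u : 'rV[R]_p | vnorm u^T <= r] =
      (fun u : 'rV[R]_p => vnorm u^T) @^-1` [set x | x <= r] by [].
  apply: closed_comp; last exact: closed_le.
  move=> u _; rewrite /vnorm.
  apply: (@continuous_comp _ _ _
    (fun u : 'rV[R]_p => \sum_(i < p) u^T i 0 ^+ 2) (@Num.sqrt R));
    last exact: sqrt_continuous.
  move: u; apply: continuous_big => [|i _ u]; first exact: add_continuous.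
  under eq_fun do rewrite mxE.
  apply: (@continuous_comp _ _ _ (fun u : 'rV[R]_p => u 0 i) (fun x => x ^+ 2)).
    exact: coord_continuous.
  exact: exprn_continuous.
move=> v /= vr i; rewrite in_itv/= -ler_norml.
apply: le_trans vr; rewrite -ler_sqr ?nnegrE ?vnorm_ge0//.
rewrite vnorm_sqrE real_normK ?num_real// (bigD1 i)//= mxE lerDl.
by apply: sumr_ge0 => j _; exact: sqr_ge0.
Qed.

(** The product replaces the sum of logarithms because, as a polynomial, it is continuous on the
    whole ball, even where factors are not positive. *)
Lemma prod_max_vnorm_ball p n (T : nat -> 'cV[R]_p) (r : R) : 0 <= r ->
  exists2 z : 'cV[R]_p, vnorm z <= r & forall u : 'cV[R]_p, vnorm u <= r ->
    \prod_(j < n) (1 + dotv u (T j)) <= \prod_(j < n) (1 + dotv z (T j)).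
Proof.
move=> r0.
pose f (u : 'rV[R]_p) := \prod_(j < n) (1 + dotv u^T (T j)).
have cf : continuous f.
  apply: continuous_big => [|j _ u]; first exact: mul_continuous.
  have cd : continuous (fun u : 'rV[R]_p => dotv u^T (T j)).
    under eq_fun do rewrite dotvE.
    apply: continuous_big => [|i _ v]; first exact: add_continuous.
    under eq_fun do rewrite mxE.
    apply: (@continuousM R _ (fun v : 'rV[R]_p => v 0 i) (fun=> T j i 0)).
      exact: coord_continuous.
    exact: cst_continuous.
  apply: (@continuousD _ R _ (fun=> 1) (fun u : 'rV[R]_p => dotv u^T (T j))).
    exact: cst_continuous.
  exact: cd.
have B0 : [set u : 'rV[R]_p | vnorm u^T <= r] !=set0.
  by exists 0; rewrite /= trmx0 vnorm0.
have [u0 u0r u0m] := EVT_max_rV B0 (@compact_vnorm_ball p r) (continuous_subspaceT cf).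
rewrite inE /= in u0r; exists u0^T => // u ur.
by have := u0m u^T; rewrite inE /= /f trmxK; exact.
Qed.

Section Solution.
Context (p n : nat) (T : nat -> 'cV[R]_p) (lam : R).
Hypothesis n0 : (0 < n)%N.
Hypothesis lam0 : 0 < lam.
Hypothesis lamT : forall u : 'cV[R]_p,
  lam * vnorm u ^+ 2 <= n%:R^-1 * \sum_(j < n) dotv u (T j) ^+ 2.

Let t0 : 0 < n%:R^-1 :> R. Proof. by rewrite invr_gt0 ltr0n. Qed.

(** Pairing the difference of the two equations with [z - z'] gives a sum of terms
    [- (x - x')^2 / ((1 + x) (1 + x'))], all of one sign; so [x = x'] at each index, and [lamT]
    forces [z = z']. *)
Lemma el_solution_unique (z z' : 'cV[R]_p) :
  el_solution n T z -> el_solution n T z' -> z = z'.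
Proof.
move=> [zp zs] [zp' zs'].
pose x j := dotv z (T j); pose x' j := dotv z' (T j).
have xp j : (j < n)%N -> 0 < 1 + x j by exact: zp.
have xp' j : (j < n)%N -> 0 < 1 + x' j by exact: zp'.
have H : n%:R^-1 * \sum_(j < n) ((1 + x j)^-1 - (1 + x' j)^-1) * (x j - x' j) = 0.
  have : n%:R^-1 *: (\sum_(j < n) (1 + x j)^-1 *: T j)
      - n%:R^-1 *: (\sum_(j < n) (1 + x' j)^-1 *: T j) = 0.
    by rewrite zs zs' subrr.
  rewrite -scalerBr -sumrB => /(congr1 (dotv (z - z'))).
  rewrite dotv0r dotvZr dotv_sumr => e.
  rewrite -[RHS]e; congr (_ * _); apply: eq_bigr => j _.
  by rewrite -scalerBl dotvZr dotvBl.
have H2 : forall j, (j < n)%N -> x j = x' j.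
  move: H => /eqP; rewrite mulf_eq0 (gt_eqF t0)/= -oppr_eq0 -sumrN psumr_eq0.
    move=> /allP H j jn; have := H (Ordinal jn) (mem_index_enum _) => /=.
    rewrite oppr_eq0 mulf_eq0 !subr_eq0 => /orP[|] /eqP// /invr_inj.
    exact: addrI.
  move=> j _; have p1 := xp _ (ltn_ord j); have p2 := xp' _ (ltn_ord j).
  have -> : - (((1 + x j)^-1 - (1 + x' j)^-1) * (x j - x' j)) =
     (x j - x' j) ^+ 2 * ((1 + x j)^-1 * (1 + x' j)^-1).
    by field; rewrite !gt_eqF.
  by rewrite mulr_ge0 ?sqr_ge0// mulr_ge0// invr_ge0 ltW.
have := lamT (z - z'); rewrite big1 ?mulr0 => [|j _]; last first.
  by rewrite dotvBl -/(x _) -/(x' _) H2// subrr expr0n.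
rewrite pmulr_rle0// => H3; apply/eqP; rewrite -subr_eq0 -vnorm_eq0.
by rewrite -sqrf_eq0 eq_le H3 sqr_ge0.
Qed.

(* The solution maximises the likelihood [prod_j (1 + u . T j)] over a ball of
   radius [r]; the strict concavity of the logarithm at scale [r] keeps the
   maximiser off the boundary, so the first-order condition holds there. *)
Lemma el_solution_exists (r tau : R) : 0 < r ->
  (forall j, (j < n)%N -> vnorm (T j) <= tau) -> r * tau <= 2^-1 ->
  vnorm (n%:R^-1 *: \sum_(j < n) T j) < r * lam / 5 ->
  exists2 z : 'cV[R]_p, el_solution n T z & vnorm z <= r.
Proof.
move=> r0 Ttau rtau Tbar.
have [z zr zmax] := prod_max_vnorm_ball n T (ltW r0).
have xb u j : vnorm u <= r -> (j < n)%N -> `|dotv u (T j)| <= 2^-1.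
  move=> ur jn; apply: le_trans (dotv_le_vnorm _ _) _; apply: le_trans rtau.
  by apply: ler_pM; rewrite ?vnorm_ge0 ?Ttau.
have xp u j : vnorm u <= r -> (j < n)%N -> 0 < 1 + dotv u (T j).
  by move=> ur jn; have := xb _ _ ur jn; rewrite ler_norml => /andP[]; lra.
have lnmax u : vnorm u <= r -> \sum_(j < n) ln ((1 + dotv u (T j))) <=
    \sum_(j < n) ln (1 + dotv z (T j)).
  move=> ur; rewrite -!ln_prod => [|j|j]; rewrite ?xp//.
  by rewrite ler_ln ?posrE ?zmax//; apply: prodr_gt0 => j _; rewrite xp.
(* On the sphere, comparison with [u = 0], whose log likelihood is 0, gives
   [0 <= r |Tbar| - lam r^2 / 5], against the strict bound on the mean. *)
have zr1 : vnorm z < r.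
  rewrite lt_neqAle zr andbT; apply/eqP => zrE.
  have := lnmax 0; rewrite vnorm0 => /(_ (ltW r0)).
  rewrite big1 => [s0|j _]; last by rewrite dotv0l addr0 ln1.
  have s1 : 0 <= \sum_(j < n) (dotv z (T j) - dotv z (T j) ^+ 2 / 5).
    apply: (le_trans s0); apply: ler_sum => j _; apply: ln1D_le_quad.
    exact: xb.
  move: s1; rewrite -(pmulr_rge0 _ t0) sumrB -mulr_suml mulrBr mulrA.
  rewrite -dotv_sumr -dotvZr => s1.
  have := lamT z; have := dotv_le_vnorm z (n%:R^-1 *: \sum_(j < n) T j).
  move/(le_trans (ler_norm _)); rewrite zrE => s2 s3.
  have : r * vnorm (n%:R^-1 *: \sum_(j < n) T j) < r * (r * lam / 5).
    by rewrite ltr_pM2l.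
  rewrite expr2 in s3; nra.
exists z => //; split=> [j jn|]; first exact: xp.
(* [g] is the gradient of the mean log likelihood at [z]; were it nonzero, a short step along it
   would beat the maximum. *)
set g := _ *: _; apply/eqP; rewrite -vnorm_eq0; apply/negP => /negP g0.
have {}g0 : 0 < vnorm g by rewrite lt_def g0 vnorm_ge0.
pose q j := (1 + dotv z (T j))^-1 * dotv g (T j).
pose V := n%:R^-1 * \sum_(j < n) q j ^+ 2.
have V0 : 0 <= V.
  by rewrite mulr_ge0 ?(ltW t0)//; apply: sumr_ge0 => j _; exact: sqr_ge0.
have gq : vnorm g ^+ 2 = n%:R^-1 * \sum_(j < n) q j.
  rewrite vnorm_sqr {2}/g dotvZr dotv_sumr; congr (_ * _).
  by apply: eq_bigr => j _; rewrite dotvZr.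
have qb j : (j < n)%N -> `|q j| <= 2 * (vnorm g * tau).
  move=> jn; rewrite normrM; apply: ler_pM => //.
    rewrite ger0_norm ?invr_ge0 ?(ltW (xp _ _ _ _))//.
    rewrite -[leRHS]invrK lef_pV2 ?posrE ?invr_gt0 ?xp//.
    by have := xb _ _ zr jn; rewrite ler_norml => /andP[]; lra.
  apply: le_trans (dotv_le_vnorm _ _) _.
  by apply: ler_wpM2l; rewrite ?vnorm_ge0// Ttau.
(* The step [s *: g] multiplies the factors by [1 + s q j], so maximality makes the sum of
   [ln (1 + s q j)] nonpositive. As [q] has mean [|g|^2], [ln1D_ge_quad] yields the claim. *)
have key s : 0 < s -> s * vnorm g <= r - vnorm z ->
    s * (2 * (vnorm g * tau)) <= 2^-1 -> vnorm g ^+ 2 <= 2 * s * V.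
  move=> s0 sr sb.
  have zg : vnorm (z + s *: g) <= r.
    by apply: le_trans (vnormD _ _) _; rewrite vnormZ gtr0_norm//; lra.
  have := lnmax _ zg.
  have E (j : 'I_n) : 1 + dotv (z + s *: g) (T j) = (1 + dotv z (T j)) * (1 + s * q j).
    by rewrite /q dotvDl dotvZl; field; rewrite gt_eqF ?xp.
  have sq (j : 'I_n) : `|s * q j| <= 2^-1.
    rewrite normrM gtr0_norm//; apply: le_trans sb.
    by rewrite ler_pM2l// qb.
  have sqp (j : 'I_n) : 0 < 1 + s * q j.
    by have := sq j; rewrite ler_norml => /andP[]; lra.
  rewrite (eq_bigr (fun j : 'I_n => ln (1 + dotv z (T j)) + ln (1 + s * q j)));
    last by move=> j _; rewrite E lnM ?posrE ?xp.
  rewrite big_split/= gerDl => s1.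
  have : \sum_(j < n) (s * q j - 2 * (s * q j) ^+ 2) <= 0.
    by apply: le_trans s1; apply: ler_sum => j _; exact: ln1D_ge_quad.
  rewrite (eq_bigr (fun j : 'I_n => s * q j - 2 * s ^+ 2 * q j ^+ 2)); last first.
    by move=> j _; ring.
  rewrite sumrB -!mulr_sumr -(pmulr_rle0 _ t0).
  rewrite [leLHS](_ : _ = s * (vnorm g ^+ 2 - 2 * s * V)); last first.
    by rewrite gq /V; ring.
  by rewrite pmulr_rle0// subr_le0.
have tau0 : 0 <= tau by apply: le_trans (Ttau _ n0); exact: vnorm_ge0.
have A1 : 0 < vnorm g * tau + 1 by rewrite ltr_pwDr// mulr_ge0// vnorm_ge0.
have A2 : 0 < V + 1 by rewrite ltr_pwDr.
(* The three terms keep the step in the ball, make [|s q j| <= 1/2], and force [2 s V <= |g|^2 / 2].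
   The added 1s keep the denominators positive. *)
pose s := Num.min ((r - vnorm z) / vnorm g)
  (Num.min ((4 * (vnorm g * tau + 1))^-1) (vnorm g ^+ 2 / (4 * (V + 1)))).
have s0 : 0 < s.
  by rewrite !lt_min divr_gt0 ?subr_gt0//= invr_gt0 divr_gt0 ?exprn_gt0 ?mulr_gt0.
have [s1 s2 s3] : [/\ s <= (r - vnorm z) / vnorm g,
   s <= (4 * (vnorm g * tau + 1))^-1 & s <= vnorm g ^+ 2 / (4 * (V + 1))].
  by rewrite /s; split; rewrite !ge_min lexx ?orbT.
have := key s s0; rewrite -ler_pdivlMr// => /(_ s1).
move: s2; rewrite -[leRHS]mul1r ler_pdivlMr ?mulr_gt0// => s2.
move: s3; rewrite ler_pdivlMr ?mulr_gt0// => s3.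
have g2 : 0 < vnorm g ^+ 2 by rewrite exprn_gt0.
have sV : 0 <= s * V by rewrite mulr_ge0// ltW.
by move=> H; have := H ltac:(nra); nra.
Qed.

End Solution.
End EmpiricalLikelihood.

(** * Expansion of the weighted mean on a single outcome *)

Section DeterministicExpansion.
Context {R : realType}.

Lemma qform_bounds p (W : 'M[R]_p) (c C : R) (u : 'cV[R]_p) :
  (forall a : 'cV[R]_p, vnorm a = 1 -> c <= qform W a <= C) ->
  c * vnorm u ^+ 2 <= dotv u (W *m u) <= C * vnorm u ^+ 2.
Proof.
move=> h; have [->|u0] := eqVneq u 0.
  by rewrite vnorm0 dotv0l expr0n/= !mulr0 lexx.
have nu0 : 0 < vnorm u by rewrite lt_def vnorm_eq0 u0 vnorm_ge0.
have := h ((vnorm u)^-1 *: u).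
rewrite vnormZ gtr0_norm ?invr_gt0// mulVf ?gt_eqF// => /(_ erefl).
rewrite /qform -mulmxA -/(dotv _ _) -scalemxAr dotvZl dotvZr mulrA.
by rewrite -invfM -expr2 mulrC ler_pdivlMr ?ler_pdivrMr ?exprn_gt0.
Qed.

Lemma qform_unitmx p (W : 'M[R]_p) (c : R) : 0 < c ->
  (forall u : 'cV[R]_p, c * vnorm u ^+ 2 <= dotv u (W *m u)) ->
  W \in unitmx.
Proof.
move=> c0 h; rewrite -unitmx_tr -row_free_unit; apply: inj_row_free => v vW.
have := h v^T; rewrite -[W *m _]trmxK trmx_mul trmxK vW trmx0 dotv0r.
rewrite pmulr_rle0// => v0; apply: trmx_inj; rewrite trmx0; apply/eqP.
by rewrite -vnorm_eq0 -sqrf_eq0 eq_le v0 sqr_ge0.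
Qed.

(** For [x = W^-1 y], [c |x|^2 <= x . W x = x . y <= |x| |y|]. *)
Lemma vnorm_invmx_le p (W : 'M[R]_p) (c : R) (y : 'cV[R]_p) : 0 < c ->
  (forall u : 'cV[R]_p, c * vnorm u ^+ 2 <= dotv u (W *m u)) ->
  vnorm (invmx W *m y) <= c^-1 * vnorm y.
Proof.
move=> c0 h; have uW := qform_unitmx c0 h.
have := h (invmx W *m y); rewrite mulmxA mulmxV// mul1mx.
have := dotv_le_vnorm (invmx W *m y) y => /(le_trans (ler_norm _)).
move=> s1 /le_trans /(_ s1); rewrite ler_pdivlMl// expr2 mulrCA.
have [->|x0] := eqVneq (vnorm (invmx W *m y)) 0.
  by rewrite mulr0 vnorm_ge0.
by rewrite ler_pM2l// lt_def x0 vnorm_ge0.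
Qed.

Lemma sum_inv1D_expand (q n : nat) (t : R) (x : 'I_n -> R) (v : 'I_n -> 'cV[R]_q) :
  (forall j, 0 < 1 + x j) ->
  t *: \sum_(j < n) (1 + x j)^-1 *: v j =
  t *: \sum_(j < n) v j - t *: \sum_(j < n) x j *: v j
  + t *: \sum_(j < n) (x j ^+ 2 / (1 + x j)) *: v j.
Proof.
move=> x0; rewrite -scalerBr -scalerDr -sumrB -big_split/=; congr (_ *: _).
apply: eq_bigr => j _; rewrite -[X in X - _ + _]scale1r -scalerBl -scalerDl.
by congr (_ *: _); field; rewrite gt_eqF.
Qed.

Section Expansion.
Context (d p n : nat) (psi : nat -> 'cV[R]_d) (T : nat -> 'cV[R]_p)
  (chibar : 'cV[R]_d) (A : 'M[R]_(d, p)) (W : 'M[R]_p).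
Context (a b c C e M B : R).
Let t : R := n%:R^-1.
Let Tbar := t *: \sum_(j < n) T j.
Let S := t *: \sum_(j < n) T j *m (T j)^T.
Let D := t *: (\sum_(j < n) psi j *m (T j)^T) - A.
(** [K (a / b)] is the radius of the ball searched for the multiplier: with [lam = c / 2], the
    threshold [r lam / 5] is [2 M (a / b)], twice the bound on [Tbar]. *)
Let K := 20 * M / c.
Let L := C + 1.
Hypotheses (n0 : (0 < n)%N) (a1 : 1 <= a) (b0 : 0 < b) (c0 : 0 < c)
  (C0 : 0 < C) (e0 : 0 < e) (M0 : 0 < M) (B0 : 0 < B).
Hypothesis W_bounds : forall u, vnorm u = 1 -> c <= qform W u <= C.
(** From here to [psi_le], one bound for each of the six events. [e] is the common tolerance behind
    every small-order condition; [M] and [B] come from boundedness in probability. *)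
Hypothesis T_le : forall j, (j < n)%N -> vnorm (T j) <= e * (a ^- 3 * b).
Hypothesis Tbar_le : vnorm Tbar <= M * (a / b).
Hypothesis SW_le : opnorm (S - W) <= e * a ^- 2.
Hypothesis D_le : frob D <= e / a.
Hypothesis chibar_le : vnorm (A *m invmx W *m Tbar - chibar) <= e / b.
Hypothesis psi_le : t * \sum_(j < n) vnorm (psi j) ^+ 2 <= B ^+ 2.
Hypotheses (e1 : e <= 1) (ec : e <= c / 2) (eK : K * e <= 2^-1).

Let t0 : 0 < t. Proof. by rewrite invr_gt0 ltr0n. Qed.
Let a0 : 0 < a. Proof. exact: lt_le_trans a1. Qed.
Let K0 : 0 < K. Proof. by rewrite divr_gt0// mulr_gt0. Qed.
Let L0 : 0 < L. Proof. by rewrite addr_gt0. Qed.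
Let W_ge (u : 'cV[R]_p) : c * vnorm u ^+ 2 <= dotv u (W *m u).
Proof. by have /andP[] := qform_bounds u W_bounds. Qed.

Let ea : e * a ^- 2 <= e.
Proof. by rewrite -[leRHS]mulr1 ler_pM2l// invf_le1 ?exprn_gt0// exprn_ege1. Qed.

Let SW_quad (u : 'cV[R]_p) :
  `|dotv u ((S - W) *m u)| <= e * vnorm u ^+ 2.
Proof.
apply: le_trans (dotv_le_vnorm _ _) _.
rewrite expr2 mulrCA; apply: ler_wpM2l; first exact: vnorm_ge0.
apply: le_trans (vnorm_mulmx_opnorm _ _) _.
by apply: ler_wpM2r; rewrite ?vnorm_ge0// (le_trans SW_le).
Qed.

Let S_ge (u : 'cV[R]_p) :
  c / 2 * vnorm u ^+ 2 <= t * \sum_(j < n) dotv u (T j) ^+ 2.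
Proof.
rewrite -dotv_scatter -/S -[S](subrK W) mulmxDl dotvDr.
have := SW_quad u; rewrite ler_norml => /andP[+ _]; have := W_ge u.
set N := vnorm u ^+ 2; have : e * N <= c / 2 * N by exact: ler_wpM2r (sqr_ge0 _) _ _ ec.
by move=> s1 s2 s3; move: s1 s2 s3; set X := dotv _ _; set Y := dotv _ _; lra.
Qed.

(** The quadratic form is at most [C + e <= L]; as [L >= 1], this may be weakened to [L^2], the
    shape that [vnorm_scaled_sum_le] expects. *)
Let S_le (u : 'cV[R]_p) :
  t * \sum_(j < n) dotv u (T j) ^+ 2 <= (L * vnorm u) ^+ 2.
Proof.
rewrite -dotv_scatter -/S -[S](subrK W) mulmxDl dotvDr.
have := SW_quad u; rewrite ler_norml => /andP[_].
have /andP[_] := qform_bounds u W_bounds.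
have := sqr_ge0 (vnorm u); rewrite exprMn.
set N := vnorm u ^+ 2 => N0 s1 s2; apply: (@le_trans _ _ (L * N)).
  have : e * N <= 1 * N by exact: ler_wpM2r.
  move=> eN; rewrite /L mulrDl addrC; apply: lerD => //.
  exact: le_trans s2 eN.
apply: ler_wpM2r => //; rewrite expr2; apply: ler_peMr; first exact: ltW.
by rewrite /L lerDr ltW.
Qed.

Let r := K * (a / b).
Let tau := e * (a ^- 3 * b).

Let r0 : 0 < r. Proof. by rewrite mulr_gt0// divr_gt0. Qed.
(** The powers of [b] cancel, so every [|z . T j|] on the ball is at most [K e a^-2]. *)
Let rtauE : r * tau = K * e * a ^- 2.
Proof. by rewrite /r /tau; field; rewrite !gt_eqF. Qed.

Let rtau_le : r * tau <= 2^-1.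
Proof.
rewrite rtauE; apply: le_trans eK; rewrite -[leRHS]mulr1 (ler_pM2l (mulr_gt0 K0 e0)).
by rewrite invf_le1 ?exprn_gt0// exprn_ege1.
Qed.

Lemma el_solution_small : exists2 z : 'cV[R]_p,
  el_solution n T z & vnorm z <= K * (a / b).
Proof.
apply: (el_solution_exists n0 S_ge r0 T_le rtau_le).
apply: (le_lt_trans Tbar_le); rewrite /r /K.
rewrite (_ : _ / 5 = 2 * (M * (a / b))); last by field; rewrite !gt_eqF.
by rewrite ltr_pMl ?mulr_gt0 ?invr_gt0// ltr1n.
Qed.

Lemma el_solution_unique_small (z z' : 'cV[R]_p) :
  el_solution n T z -> el_solution n T z' -> z = z'.
Proof. by apply: (el_solution_unique n0 _ S_ge); rewrite divr_gt0. Qed.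

Let psi_quad (u : 'cV[R]_d) :
  t * \sum_(j < n) dotv u (psi j) ^+ 2 <= (B * vnorm u) ^+ 2.
Proof.
apply: (@le_trans _ _ (t * \sum_(j < n) vnorm u ^+ 2 * vnorm (psi j) ^+ 2)).
  rewrite ler_pM2l//; apply: ler_sum => j _.
  rewrite -exprMn -[leLHS]real_normK ?num_real//.
  by rewrite ler_sqr ?nnegrE ?mulr_ge0 ?vnorm_ge0// dotv_le_vnorm.
rewrite -mulr_sumr mulrCA exprMn mulrC.
by apply: ler_wpM2r; rewrite ?sqr_ge0.
Qed.

(** The error splits into the term of [chibar_le], the image of [R2 - (S - W) z] under [A W^-1],
    [D z], and [R3]; each is a constant times [e / b]. *)
Lemma el_weighted_mean_expansion (z : 'cV[R]_p) : el_solution n T z ->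
  vnorm (t *: \sum_(j < n) (1 + dotv z (T j))^-1 *: psi j
    - (t *: \sum_(j < n) psi j - chibar)) <=
  e * (1 + K + 2 * K ^+ 2 * B * L
       + (B * L + 1) / c * (K + 2 * K ^+ 2 * L ^+ 2)) / b.
Proof.
(* The solution is arbitrary; uniqueness identifies it with the small one. *)
move=> zsol; have zr : vnorm z <= r.
  have [z' z'sol z'r] := el_solution_small.
  by rewrite (el_solution_unique_small zsol z'sol).
have [zpos zeq] := zsol.
pose x (j : 'I_n) := dotv z (T j).
have xp j : 0 < 1 + x j by exact: zpos.
pose y j := x j ^+ 2 / (1 + x j).
have tau0 : 0 <= tau by apply: le_trans (T_le n0); exact: vnorm_ge0.
have rt0 : 0 <= r * tau := mulr_ge0 (ltW r0) tau0.
have q0 : 0 <= 2 * K ^+ 2 * L * e / b.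
  apply: divr_ge0; last exact: ltW.
  apply: mulr_ge0; last exact: ltW.
  apply: mulr_ge0; last exact: ltW.
  by apply: mulr_ge0 => //; exact: sqr_ge0.
have xr j : `|x j| <= r * tau.
  apply: le_trans (dotv_le_vnorm _ _) _.
  by apply: ler_pM; rewrite ?vnorm_ge0 ?T_le.
have ab : 2 * (r * tau) * (L * r) <= 2 * K ^+ 2 * L * e / b.
  rewrite rtauE /r.
  have -> : 2 * (K * e * a ^- 2) * (L * (K * (a / b))) =
      2 * K ^+ 2 * L * e / b * a^-1 by field; rewrite !gt_eqF.
  by rewrite ler_piMr ?invf_le1// !mulr_ge0 ?invr_ge0 ?exprn_ge0// ltW.
(* [y j] is [x j / (1 + x j)], at most [2 r tau] in size, times [x j], of mean square at most
   [(L r)^2]. A spare factor [1 / a] is dropped in [ab]. *)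
have y_le : t * \sum_(j < n) y j ^+ 2 <= (2 * K ^+ 2 * L * e / b) ^+ 2.
  apply: (@le_trans _ _ ((2 * (r * tau)) ^+ 2 * (t * \sum_(j < n) x j ^+ 2))).
    rewrite mulrCA ler_pM2l// mulr_sumr; apply: ler_sum => j _.
    have p2 : (1 + x j)^-1 <= 2.
      rewrite -[leRHS]invrK lef_pV2 ?posrE ?invr_gt0//.
      by have := le_trans (xr j) rtau_le; rewrite ler_norml => /andP[]; lra.
    have -> : y j = x j / (1 + x j) * x j by rewrite /y; ring.
    rewrite exprMn; apply: ler_wpM2r; first exact: sqr_ge0.
    rewrite -[leLHS]real_normK ?num_real// ler_sqr ?nnegrE//; last first.
      by rewrite mulr_ge0// mulr_ge0// ltW.
    rewrite normrM [2 * _]mulrC [`|_^-1|]gtr0_norm ?invr_gt0//.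
    by apply: ler_pM; rewrite ?invr_ge0 ?(ltW (xp j)).
  apply: (@le_trans _ _ ((2 * (r * tau)) ^+ 2 * (L * r) ^+ 2)).
    apply: ler_wpM2l; first exact: sqr_ge0.
    apply: (le_trans (S_le z)).
    by rewrite lerXn2r ?nnegrE ?(mulr_ge0 (ltW L0) _) ?vnorm_ge0 ?(ltW r0)// ler_pM2l.
  rewrite -exprMn lerXn2r ?nnegrE//.
  exact: mulr_ge0 (mulr_ge0 (ler0n _ 2) rt0) (mulr_ge0 (ltW L0) (ltW r0)).
pose R2 := t *: \sum_(j < n) y j *: T j.
pose R3 := t *: \sum_(j < n) y j *: psi j.
have R2_le : vnorm R2 <= L * (2 * K ^+ 2 * L * e / b).
  by apply: vnorm_scaled_sum_le => //; rewrite ltW.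
have R3_le : vnorm R3 <= B * (2 * K ^+ 2 * L * e / b).
  by apply: vnorm_scaled_sum_le => //; rewrite ltW.
pose P := t *: \sum_(j < n) psi j *m (T j)^T.
have P_le (u : 'cV[R]_p) : vnorm (P *m u) <= B * L * vnorm u.
  rewrite /P mulmx_sum_outer -mulrA; apply: vnorm_scaled_sum_le => //; try exact: ltW.
  by rewrite mulr_ge0 ?vnorm_ge0 ?(ltW L0).
have D_vec (u : 'cV[R]_p) : vnorm (D *m u) <= e / a * vnorm u.
  apply: le_trans (vnorm_mulmx_frob _ _) _.
  by apply: ler_wpM2r; rewrite ?vnorm_ge0.
(* The bound on [A] is inherited from [P = A + D], with [P] bounded by Cauchy-Schwarz. *)
have A_le (u : 'cV[R]_p) : vnorm (A *m u) <= (B * L + 1) * vnorm u.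
  have -> : A = P - D by rewrite /D opprB addrC subrK.
  rewrite mulmxBl; apply: le_trans (vnormB _ _) _.
  rewrite mulrDl; apply: lerD => //; apply: le_trans (D_vec u) _.
  apply: ler_wpM2r; first exact: vnorm_ge0.
  by rewrite ler_pdivrMr// mul1r (le_trans e1).
have uW := qform_unitmx c0 W_ge.
(* The expanded estimating equation reads [0 = Tbar - S z + R2]. *)
have SzE : S *m z = Tbar + R2.
  have := sum_inv1D_expand t (fun j : 'I_n => T j) xp.
  rewrite [LHS]zeq -mulmx_sum_outer -/S -/Tbar -/R2 => /esym/eqP.
  by rewrite addrAC subr_eq0 => /eqP.
have WzE : z = invmx W *m Tbar + invmx W *m (R2 - (S - W) *m z).
  rewrite -mulmxDr addrA -SzE mulmxBl opprB addrC subrK.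
  by rewrite mulmxA mulVmx// mul1mx.
have -> : t *: \sum_(j < n) (1 + dotv z (T j))^-1 *: psi j
    - (t *: \sum_(j < n) psi j - chibar) =
    - (A *m invmx W *m Tbar - chibar)
    - A *m (invmx W *m (R2 - (S - W) *m z)) - D *m z + R3.
  rewrite (sum_inv1D_expand t (fun j : 'I_n => psi j) xp) -mulmx_sum_outer -/P -/R3.
  have -> : P *m z = D *m z + A *m z by rewrite -mulmxDl subrK.
  (* Only the [z] under [A] is expanded; [D z] stays, since [frob D <= e / a] absorbs the [a] in
     [|z| <= K (a / b)]. *)
  rewrite [in A *m z]WzE mulmxDr mulmxA.
  move: (t *: _) (D *m z) (A *m invmx W *m Tbar) (A *m _) => v1 v2 v3 v4.
  by move: R3 {R3_le} => v5; apply/colP => k; rewrite !mxE; ring.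
have SWz_le : vnorm ((S - W) *m z) <= K * e / b.
  apply: le_trans (vnorm_mulmx_opnorm _ _) _.
  apply: (@le_trans _ _ (e * a ^- 2 * r)).
    apply: (@le_trans _ _ (e * a ^- 2 * vnorm z)).
      by apply: ler_wpM2r => //; exact: vnorm_ge0.
    by apply: ler_wpM2l => //; rewrite divr_ge0 ?exprn_ge0// ltW.
  rewrite /r (_ : _ * _ = K * e / b * a^-1); last by field; rewrite !gt_eqF.
  by rewrite ler_piMr ?invf_le1// !mulr_ge0 ?invr_ge0// ltW.
have Dz_le : vnorm (D *m z) <= K * e / b.
  apply: le_trans (D_vec _) _; apply: (@le_trans _ _ (e / a * r)).
    by apply: ler_wpM2l => //; rewrite divr_ge0// ltW.
  by rewrite /r le_eqVlt; apply/orP; left; apply/eqP; field; rewrite !gt_eqF.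
have AW_le : vnorm (A *m (invmx W *m (R2 - (S - W) *m z))) <=
    (B * L + 1) * (c^-1 * (L * (2 * K ^+ 2 * L * e / b) + K * e / b)).
  apply: (le_trans (A_le _)); apply: ler_wpM2l.
    by rewrite addr_ge0// mulr_ge0// ltW.
  apply: (le_trans (vnorm_invmx_le _ c0 W_ge)); apply: ler_wpM2l.
    by rewrite invr_ge0 ltW.
  by apply: (le_trans (vnormB _ _)); exact: lerD.
have -> : e * (1 + K + 2 * K ^+ 2 * B * L
       + (B * L + 1) / c * (K + 2 * K ^+ 2 * L ^+ 2)) / b =
   e / b + (B * L + 1) * (c^-1 * (L * (2 * K ^+ 2 * L * e / b) + K * e / b))
   + K * e / b + B * (2 * K ^+ 2 * L * e / b).
  by field; rewrite !gt_eqF.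
apply: le_trans (vnormD _ _) _; apply: lerD => //.
apply: le_trans (vnormB _ _) _; apply: lerD => //.
apply: le_trans (vnormB _ _) _; apply: lerD => //.
by rewrite vnormN.
Qed.

End Expansion.
End DeterministicExpansion.

(** * Small outer probabilities and Markov bounds *)

Section StochasticOrders.
Context {R : realType} {d0 : measure_display} {Om : measurableType d0}.
Variable P : probability Om R.

Lemma pr_small_sub (A B : set Om) (delta : R) :
  A `<=` B -> pr_small P B delta -> pr_small P A delta.
Proof. by move=> AB [C [mC [BC PC]]]; exists C; split=> //; split=> // w /AB/BC. Qed.

Lemma pr_smallU (A B : set Om) (delta eta : R) :
  pr_small P A delta -> pr_small P B eta -> pr_small P (A `|` B) (delta + eta).
Proof.
move=> [C [mC [AC PC]]] [D [mD [BD PD]]]; exists (C `|` D).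
split; first exact: measurableU.
split; first exact: setUSS.
apply: le_lt_trans (measureU2 _ mC mD) _.
by rewrite EFinD lteD.
Qed.

(* The complement of [E n] covers [N n] and has probability within [1/(n+1)] of
   its outer probability. *)
Lemma exists_large_events (N : nat -> set Om) :
  (forall delta : R, 0 < delta -> \forall n \near \oo, pr_small P (N n) delta) ->
  exists E : nat -> set Om, [/\ forall n, measurable (E n),
    (fun n => P (E n)) @ \oo --> 1%E & forall n, E n `<=` ~` N n].
Proof.
move=> Nsmall.
(* [N n] may fail to be measurable; the infimum of [V n] is its outer probability. *)
pose V n : set R := [set fine (P B) | B in [set B | measurable B /\ N n `<=` B]].
have Vinf n : has_inf (V n).
  split; first by exists (fine (P setT)), setT.
  by exists 0 => _ [B _ <-]; exact: fine_ge0.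
have /choice [B BP] : forall n, exists B, [/\ measurable B, N n `<=` B &
    fine (P B) < inf (V n) + n.+1%:R^-1].
  move=> n; have n0 : 0 < n.+1%:R^-1 :> R by [].
  by have [_ [B [mB NB] <-] BV] := inf_adherent n0 (Vinf n); exists B.
have mB n : measurable (B n) by have [] := BP n.
exists (fun n => ~` B n); split => [n||n]; first exact: measurableC; last first.
  by apply: subsetC; have [] := BP n.
have PE n : P (~` B n) = (1 - fine (P (B n)))%:E.
  by rewrite probability_setC// EFinB fineK// fin_num_measure.
apply: cvg_EFin; first by near=> n; rewrite PE.
apply/cvgrPdist_lt => e e0; have e2 : 0 < e / 2 by rewrite divr_gt0.
near=> n.
rewrite /= PE /= opprB addrC subrK.
rewrite ger0_norm ?fine_ge0//.
have [_ _ /lt_le_trans] := BP n; apply.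
(* A cover [C] of probability below [e / 2] bounds [inf (V n)]; the slack [1 / (n + 1)] takes the
   other half. *)
have [C [mC [NC PC]]] : pr_small P (N n) (e / 2) by near: n; exact: Nsmall.
have : inf (V n) <= fine (P C) by apply: ge_inf; [exact: (Vinf n).2|exists C].
have : fine (P C) < e / 2 by rewrite -lte_fin fineK// fin_num_measure.
have : n.+1%:R^-1 < e / 2 :> R by near: n; exact: near_infty_natSinv_lt (PosNum e2).
move=> nV PCe VC; rewrite [leRHS]splitr; apply: lerD; last exact: ltW.
by rewrite (le_trans VC)// ltW.
Unshelve. all: by end_near. Qed.

(** Integrating [K <= f] over the set bounds [K] times its probability by [v]; the strict
    [v < K * delta] gives the strict inequality in [pr_small]. *)
Lemma pr_small_markov (f : Om -> R) (v K delta : R) :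
  measurable_fun setT f -> (forall w, 0 <= f w) ->
  (\int[P]_w (f w)%:E <= v%:E)%E -> 0 < K -> v < K * delta ->
  pr_small P [set w | K < f w] delta.
Proof.
move=> mf f0 fv K0 vK; exists [set w | K < f w].
have mA : measurable [set w | K < f w].
  rewrite -[X in measurable X]setTI.
  have mfE : measurable_fun setT (EFin \o f) by exact/measurable_EFinP.
  exact: emeasurable_fun_o_infty measurableT mfE K%:E.
split=> //; split=> //.
have : (\int[P]_(w in [set w | (K < f w)%R]) (cst K%:E) w <= v%:E)%E.
  apply: le_trans fv.
  apply: (@le_trans _ _ (\int[P]_(w in [set w | (K < f w)%R]) (f w)%:E)%E).
    apply: ge0_le_integral => //.
    - by move=> w _; rewrite lee_fin ltW.
    - by apply/measurable_EFinP; exact: measurable_funTS.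
    - by move=> w /= /ltW; rewrite lee_fin.
  apply: ge0_subset_integral => //.
    by apply/measurable_EFinP.
  by move=> w _; rewrite lee_fin.
rewrite integral_cst// => h.
have {h} : (K%:E * P [set w | (K < f w)%R] <= v%:E)%E := h.
rewrite -(fineK (fin_num_measure P _ mA)) -EFinM lee_fin lte_fin.
by move=> h; rewrite -(ltr_pM2l K0); exact: le_lt_trans vK.
Qed.

(** Each summand integrates to [v] by change of variables. The inequality also covers [n = 0], where
    the mean is 0. *)
Lemma integral_mean_identically_distributed (d1 : measure_display)
    (Zs : measurableType d1) (Q : probability Zs R) (Z : nat -> Om -> Zs)
    (g : Zs -> R) (v : R) (n : nat) :
  (forall j, measurable_fun setT (Z j)) ->
  (forall j (B : set Zs), measurable B -> P (Z j @^-1` B) = Q B) ->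
  measurable_fun setT g -> (forall z, 0 <= g z) ->
  (\int[Q]_z (g z)%:E)%E = v%:E ->
  (\int[P]_w (n%:R^-1 * \sum_(j < n) g (Z j w))%:E <= v%:E)%E.
Proof.
move=> mZ dZ mg g0 gv.
have v0 : 0 <= v by rewrite -lee_fin -gv; apply: integral_ge0 => z _; rewrite lee_fin.
have mgE : measurable_fun setT (EFin \o g) by exact/measurable_EFinP.
have gZ j : (\int[P]_w (g (Z j w))%:E = \int[Q]_z (g z)%:E)%E.
  transitivity (\int[pushforward P (Z j)]_z (g z)%:E)%E.
    by rewrite (ge0_integral_pushforward (mZ j))//= => z _; rewrite lee_fin.
  by apply: eq_measure_integral => A mA _; exact: dZ.
have mgZ j : measurable_fun setT (fun w => (g (Z j w))%:E).
  by apply/measurable_EFinP; exact: measurableT_comp.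
under eq_integral => w _ do rewrite EFinM -sumEFin.
rewrite ge0_integralZl_EFin//; last 2 first.
- by move=> w _; apply: sume_ge0 => j _; rewrite lee_fin.
- exact: emeasurable_sum.
rewrite ge0_integral_sum//; last by move=> j w _; rewrite lee_fin.
under eq_bigr do rewrite gZ gv.
rewrite sumEFin -EFinM lee_fin sumr_const card_ord -[v *+ _]mulr_natl.
case: n => [|n]; first by rewrite mulr0n mul0r mulr0.
by rewrite mulKf// pnatr_eq0.
Qed.

(** Markov's inequality with [B^2 = (v + 1) / delta], [v] being the second moment; the added 1 gives
    both [B > 0] and [v < B^2 delta]. *)
Lemma mean_sqnorm_bounded (d1 : measure_display)
    (Zs : measurableType d1) (Q : probability Zs R) (Z : nat -> Om -> Zs)
    (d : nat) (psi : Zs -> 'cV[R]_d) :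
  iid_seq P Q Z ->
  (forall k : 'I_d, measurable_fun setT (fun z => psi z k 0)) ->
  (\int[Q]_z ((vnorm (psi z)) ^+ 2)%:E < +oo)%E ->
  forall delta : R, 0 < delta -> exists2 B : R, 0 < B & forall n : nat,
    pr_small P [set w | B ^+ 2 < n%:R^-1 * \sum_(j < n) vnorm (psi (Z j w)) ^+ 2] delta.
Proof.
move=> [mZ [dZ _]] mpsi psi2 delta delta0.
pose g z := vnorm (psi z) ^+ 2.
have mg : measurable_fun setT g.
  rewrite /g; under eq_fun do rewrite vnorm_sqrE.
  by apply: measurable_sum => k; apply: measurable_funX.
have g0 z : 0 <= g z by exact: sqr_ge0.
pose v := fine (\int[Q]_z (g z)%:E)%E.
have vE : (\int[Q]_z (g z)%:E)%E = v%:E.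
  by rewrite /v fineK// ge0_fin_numE//; apply: integral_ge0 => z _; rewrite lee_fin.
have v0 : 0 <= v by apply: fine_ge0; apply: integral_ge0 => z _; rewrite lee_fin.
have B0 : 0 < (v + 1) / delta by rewrite divr_gt0// ltr_wpDl.
exists (Num.sqrt ((v + 1) / delta)) => [|n]; first by rewrite sqrtr_gt0.
rewrite sqr_sqrtr ?(ltW B0)//; apply: (@pr_small_markov _ v) => //.
- apply: measurable_funM; first exact: measurable_cst.
  by apply: measurable_sum => j; apply: (measurableT_comp mg).
- by move=> w; rewrite mulr_ge0 ?invr_ge0//; apply: sumr_ge0 => j _; exact: g0.
- exact: integral_mean_identically_distributed vE.
- by rewrite divfK ?gt_eqF// ltrDl.
Qed.

End StochasticOrders.

(** * Half-integer powers as square roots *)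

Lemma powR_half {R : realType} (x : R) : 0 <= x -> x `^ (1 / 2) = Num.sqrt x.
Proof. by move=> x0; rewrite div1r powR12_sqrt. Qed.

Lemma powR_Nhalf {R : realType} (x : R) : 0 <= x ->
  x `^ (- (1 / 2)) = (Num.sqrt x)^-1.
Proof. by move=> x0; rewrite powRN powR_half. Qed.

Lemma powR_N3half {R : realType} (x : R) : 0 <= x ->
  x `^ (- (3 / 2)) = Num.sqrt x ^- 3.
Proof.
move=> x0; rewrite powRN (_ : 3 / 2 = 2^-1 * 3); last by rewrite mulrC.
by rewrite powRrM powR12_sqrt// powR_mulrn// sqrtr_ge0.
Qed.

(** * Assembly on events of large probability *)

Unset Implicit Arguments. Set Strict Implicit.

Theorem theorem5 (R : realType)
  (d0 : measure_display) (Om : measurableType d0) (P : probability Om R)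
  (d1 : measure_display) (Zs : measurableType d1) (Q : probability Zs R)
  (Z : nat -> Om -> Zs) (d : nat) (psi : Zs -> 'cV[R]_d)
  (m : nat -> nat) (T : forall n : nat, nat -> Om -> 'cV[R]_(m n))
  (W : forall n : nat, 'M[R]_(m n)) (chi : Zs -> 'cV[R]_d) :
  (* Z_1, Z_2, ... i.i.d. with distribution Q *)
  iid_seq P Q Z ->
  (* psi measurable, square integrable *)
  (forall k : 'I_d, measurable_fun setT (fun z => psi z k 0)) ->
  (\int[Q]_z ((vnorm (psi z)) ^+ 2)%:E < +oo)%E ->
  (* m_n -> oo *)
  (forall M : nat, \forall n \near \oo, (M <= m n)%N) ->
  (* T_{nj} are random vectors *)
  (forall n j (i : 'I_(m n)), measurable_fun setT (fun w => T n j w i 0)) ->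
  (* the expectations E(psi(Z_j) T_{nj}^T) exist *)
  (forall n j (k : 'I_d) (i : 'I_(m n)),
     P.-integrable setT (fun w => (psi (Z j w) k 0 * T n j w i 0)%:E)) ->
  (* (A1) *)
  o_p P (fun n w => \big[Num.max/0]_(j < n) vnorm (T n j w))
        (fun n => (m n)%:R `^ (- (3 / 2)) * n%:R `^ (1 / 2)) ->
  (* (A2) *)
  O_p P (fun n w => vnorm (n%:R^-1 *: \sum_(j < n) T n j w))
        (fun n => (m n)%:R `^ (1 / 2) * n%:R `^ (- (1 / 2))) ->
  (* (A3) *)
  regular_seq W ->
  o_p P (fun n w => opnorm (n%:R^-1 *: \sum_(j < n) (T n j w *m (T n j w)^T) - W n))
        (fun n => (m n)%:R ^-1) ->
  (* (B1) *)
  o_p P (fun n w => frob (n%:R^-1 *: \sum_(j < n)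
            (psi (Z j w) *m (T n j w)^T
             - expmx P (fun w' => psi (Z j w') *m (T n j w')^T))))
        (fun n => (m n)%:R `^ (- (1 / 2))) ->
  (* (B2) *)
  (forall k : 'I_d, measurable_fun setT (fun z => chi z k 0)) ->
  (forall k : 'I_d, (\int[Q]_z (chi z k 0)%:E = 0)%E) ->
  (\int[Q]_z ((vnorm (chi z)) ^+ 2)%:E < +oo)%E ->
  o_p P (fun n w => vnorm (n%:R^-1 *: \sum_(i < n)
            ((n%:R^-1 *: \sum_(j < n)
                 expmx P (fun w' => psi (Z j w') *m (T n j w')^T))
               *m invmx (W n) *m T n i w - chi (Z i w))))
        (fun n => n%:R `^ (- (1 / 2))) ->
  (* conclusion *)
  exists (E : nat -> set Om) (zeta : forall n : nat, Om -> 'cV[R]_(m n)),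
    (forall n, measurable (E n)) /\
    ((fun n => P (E n)) @ \oo --> 1%E) /\
    (forall n w, E n w ->
       el_solution n (fun j => T n j w) (zeta n w) /\
       (forall z : 'cV[R]_(m n), el_solution n (fun j => T n j w) z -> z = zeta n w)) /\
    o_p P (fun n w => vnorm (
             n%:R^-1 *: \sum_(j < n)
               ((1 + ((zeta n w)^T *m T n j w) 0 0)^-1 *: psi (Z j w))
             - (n%:R^-1 *: \sum_(j < n) psi (Z j w)
                - n%:R^-1 *: \sum_(j < n) chi (Z j w))))
          (fun n => n%:R `^ (- (1 / 2))).

Proof.
move=> iidZ mpsi psi2 moo _ _ A1 A2 [_ [c [C' [c0 W_bounds0]]]] A3 B1 _ _ _ B2.
have [C C0 W_bounds] : exists2 C : R, 0 < C & forall n (a : 'cV[R]_(m n)),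
    vnorm a = 1 -> c <= qform (W n) a <= C.
  exists (Num.max C' 1) => [|n a /W_bounds0]; first by rewrite lt_max ltr01 orbT.
  by rewrite le_max => /andP[-> ->].
pose dev n w (z : 'cV[R]_(m n)) := vnorm (
  n%:R^-1 *: \sum_(j < n) ((1 + (z^T *m T n j w) 0 0)^-1 *: psi (Z j w))
  - (n%:R^-1 *: \sum_(j < n) psi (Z j w) - n%:R^-1 *: \sum_(j < n) chi (Z j w))).
pose sol n w := el_solution n (fun j => T n j w).
(* Accuracy is asked of every solution, so that one choice of [zeta] serves all [eps] at once. *)
pose good n w (eps : R) := (exists z, sol n w z /\ forall z', sol n w z' -> z' = z)
  /\ (forall z, sol n w z -> dev n w z <= eps * n%:R `^ (- (1 / 2))).
have key (eps delta : R) : 0 < eps -> 0 < delta ->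
    \forall n \near \oo, pr_small P [set w | ~ good n w eps] delta.
  (* A sixth of [delta] goes to each of the six exceptional sets. *)
  move=> eps0 delta0; pose eta := delta / 6.
  have eta0 : 0 < eta by rewrite divr_gt0.
  have [M [M0 {}A2]] := A2 _ eta0.
  have [B B0 psiB] := mean_sqnorm_bounded iidZ mpsi psi2 eta0.
  pose K := 20 * M / c; pose L := C + 1.
  have K0 : 0 < K by rewrite divr_gt0// mulr_gt0.
  have L0 : 0 < L by rewrite addr_gt0.
  (* [G] is the bracket in [el_weighted_mean_expansion], so the final error is at most [e G / b]. *)
  pose G := 1 + K + 2 * K ^+ 2 * B * L
       + (B * L + 1) / c * (K + 2 * K ^+ 2 * L ^+ 2).
  have G0 : 0 < G.
    have BL0 : 0 < B * L by exact: mulr_gt0.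
    have K20 : 0 < K ^+ 2 by exact: exprn_gt0.
    have L20 : 0 < L ^+ 2 by exact: exprn_gt0.
    have BLc0 : 0 < (B * L + 1) / c by rewrite divr_gt0// addr_gt0.
    have s1 : 0 < K ^+ 2 * (B * L) by exact: mulr_gt0.
    have s2 : 0 < K ^+ 2 * L ^+ 2 by exact: mulr_gt0.
    have s3 : 0 < (B * L + 1) / c * (K + 2 * K ^+ 2 * L ^+ 2).
      by apply: mulr_gt0 => //; rewrite -mulrA; lra.
    rewrite /G -mulrA -[2 * _ * _]mulrA; lra.
  (* The last two terms secure [r tau <= 1/2] and [e G <= eps]. *)
  pose e := Num.min 1 (Num.min (c / 2) (Num.min ((2 * K)^-1) (eps / G))).
  have e0 : 0 < e by rewrite !lt_min ltr01 !divr_gt0// invr_gt0 mulr_gt0.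
  have [e1 ec eK eG] : [/\ e <= 1, e <= c / 2, K * e <= 2^-1 & e * G <= eps].
    have [e1 ec eK eG] :
        [/\ e <= 1, e <= c / 2, e <= (2 * K)^-1 & e <= eps / G].
      by rewrite /e; split; rewrite !ge_min lexx ?orbT.
    split=> //; last by rewrite -ler_pdivlMr.
    by rewrite mulrC -ler_pdivlMr// -invfM.
  have FI := @filterI _ _ eventually_filter.
  have F := FI _ _ (nbhs_infty_gt 0) (FI _ _ (moo 1)
    (FI _ _ (A1 _ _ e0 eta0) (FI _ _ A2 (FI _ _ (A3 _ _ e0 eta0)
    (FI _ _ (B1 _ _ e0 eta0) (B2 _ _ e0 eta0)))))).
  apply: filterS F => n [n0 [m0 [pA1 [pA2 [pA3 [pB1 pB2]]]]]].
  have := pr_smallU pB2 (pr_smallU pB1 (pr_smallU pA3 (pr_smallU pA2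
    (pr_smallU pA1 (psiB n))))).
  rewrite (_ : eta + _ = delta); last by rewrite /eta; field.
  (* By contraposition: an outcome outside all six exceptional sets meets the deterministic
     hypotheses, hence is good. *)
  apply: pr_small_sub => w /= ngood.
  apply: contrapT => /not_orP[hB2] /not_orP[hB1] /not_orP[hA3] /not_orP[hA2].
  move=> /not_orP[hA1 hpsi]; apply: ngood.
  move: hB2 hB1 hA3 hA2 hA1 hpsi.
  move=> /negP + /negP + /negP + /negP + /negP + /negP.
  rewrite -!leNgt => hB2 hB1 hA3 hA2 hA1 hpsi.
  pose a : R := Num.sqrt (m n)%:R; pose b : R := Num.sqrt n%:R.
  have a1 : 1 <= a by rewrite -sqrtr1 ler_wsqrtr// ler1n.
  have b0 : 0 < b by rewrite sqrtr_gt0 ltr0n.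
  have T_le j : (j < n)%N -> vnorm (T n j w) <= e * (a ^- 3 * b).
    move=> jn; rewrite /a /b -powR_N3half ?ler0n// -powR_half ?ler0n//.
    apply: le_trans hA1.
    exact: (le_bigmax _ (fun i : 'I_n => vnorm (T n i w)) (Ordinal jn)).
  rewrite powR_half ?ler0n// powR_Nhalf ?ler0n// in hA2.
  have {}hA3 : opnorm (n%:R^-1 *: (\sum_(j < n) T n j w *m (T n j w)^T) - W n)
    <= e * a ^- 2 by rewrite sqr_sqrtr ?ler0n.
  (* Pulling the centring out of the sums turns the two averages into [D] and
     [A W^-1 Tbar - chibar]. *)
  rewrite sumrB scalerBr powR_Nhalf ?ler0n// in hB1.
  rewrite sumrB scalerBr -mulmx_sumr scalemxAr powR_Nhalf ?ler0n// in hB2.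
  split.
    have [z zsol _] := el_solution_small n0 a1 b0 c0 e0 M0 (W_bounds n) T_le
      hA2 hA3 ec eK.
    exists z; split=> // z' z'sol.
    exact: (el_solution_unique_small n0 a1 c0 e0 (W_bounds n) hA3 ec z'sol zsol).
  move=> z zsol; rewrite powR_Nhalf ?ler0n//.
  have := el_weighted_mean_expansion
    (psi := fun j => psi (Z j w)) n0 a1 b0 c0 C0 e0 M0 B0 (W_bounds n) T_le
    hA2 hA3 hB1 hB2 hpsi e1 ec eK zsol.
  by move/le_trans; apply; rewrite ler_pM2r// invr_gt0.
(* Any positive [eps] would do here, as unique solvability does not involve it. *)
have [E [mE PE EN]] := exists_large_events (fun delta => key 1 delta ltr01).
(* [zeta] takes the default value 0 where no solution exists, which happens only off [E n]. *)
exists E, (fun n w => xget 0 [set z | sol n w z]); split=> //; split=> //; split.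
  move=> n w /EN /= /contrapT[[z [zsol zuniq]] _].
  have xsol : sol n w (xget 0 [set z | sol n w z]) by apply: xgetPex; exists z.
  by split=> // z' /zuniq ->; rewrite (zuniq _ xsol).
move=> eps delta eps0 delta0.
apply: filterS (key _ _ eps0 delta0) => n; apply: pr_small_sub => w /= ltdev.
move=> [[z [zsol _]] /(_ (xget 0 [set z | sol n w z]))].
have xsol : sol n w (xget 0 [set z | sol n w z]) by apply: xgetPex; exists z.
by move/(_ xsol); rewrite leNgt ltdev.
Qed.
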